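(* Let $f:\mathbb{R}^d\to\mathbb{R}$ be convex and differentiable with $L_f$-Lipschitz continuous gradient ($L_f>0$), let $g:\mathbb{R}^r\to\mathbb{R}$ be convex and Lipschitz continuous, let $B\in\mathbb{R}^{r\times d}$ be nonzero, and let $0<\lambda\le\frac1{\rho_{\max}(BB^T)}$. For $k\ge 1$ set $$\theta_k=\frac{2}{k+1},\qquad \gamma_k=\frac{1}{L_f+ck},\qquad 0<c<L_f .$$ Then the following conditions hold: for all $k\ge1$, $0<\gamma_k\le\frac1{L_f}$, $\frac{\gamma_{k+1}}{\gamma_k}\le\frac{\theta_{k+1}^2}{\theta_k^2(1-\theta_{k+1})}$ and $\frac{\gamma_k}{\gamma_{k+1}}\le\frac1{1-\theta_{k+1}}$; the sequence $\frac{\gamma_k^2}{\theta_k^2}$ is increasing and uniformly bounded; and $\theta_1=1$. Moreover, let $(x_k,y_k,x_k^{\rm ag},y_k^{\rm ag})_{k\ge1}$ be generated by the APDFP algorithm with these parameters from arbitrary $x_1=x_1^{\rm ag}\in\mathbb{R}^d$, $y_1=y_1^{\rm ag}\in\mathbb{R}^r$; assume the min-max problem $\min_{x\in\mathbb{R}^d}\max_{y\in Y} f(x)+\langle Bx,y\rangle-g^*(y)$ has a saddle point, and let $B_1\subset\mathbb{R}^d$, $B_2\subset Y$ be bounded sets such that $B_1\times B_2$ contains a saddle point. Then there are finite constants $\Omega_1\ge0$ (related to $B_1$) and $\Omega_2\ge0$ (related to $B_2$), neither depending on $k$, such that for every $k\ge1$ $$\mathcal{G}_{B_1\times B_2}(x_{k+1}^{\rm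 ag},y_{k+1}^{\rm ag})\le\frac{2L_f}{(k+1)^2}\Omega_1+\frac{2ck}{(k+1)^2}\Omega_1+\frac{1}{2(L_f+ck)}\,\frac{\rho_{\max}(I-\lambda BB^T)}{\lambda}\,\Omega_2 .$$
   Context: $\rho_{\max}(\cdot)$ denotes the largest eigenvalue of a symmetric matrix. $g^*$ is the convex conjugate of $g$ and $Y=\{y\in\mathbb{R}^r: g^*(y)<+\infty\}$ its domain. For $\gamma>0$ and a proper convex l.s.c. function $h$, $\mathrm{Prox}_{\gamma h}(s)=\arg\min_{y}\{\gamma h(y)+\frac12\|y-s\|_2^2\}$. APDFP algorithm: given $\lambda>0$, $\gamma_k>0$, $\theta_k\in(0,1]$, and $x_1=x_1^{\rm ag}$, $y_1=y_1^{\rm ag}$, for $k=1,2,\dots$ set $$\begin{aligned} x_k^{\rm md}&=(1-\theta_k)x_k^{\rm ag}+\theta_kx_k,\\ \overline{x}_k&=x_k-\tfrac{\gamma_k}{\theta_k}\nabla f(x_k^{\rm md})-\tfrac{\gamma_k}{\theta_k}B^Ty_k,\\ y_{k+1}&=\mathrm{Prox}_{\frac{\lambda\theta_k}{\gamma_k}g^*}\!\left(\tfrac{\lambda\theta_k}{\gamma_k}B\overline{x}_k+y_k\right),\\ x_{k+1}&=x_k-\tfrac{\gamma_k}{\theta_k}\nabla f(x_k^{\rm md})-\tfrac{\gamma_k}{\theta_k}B^Ty_{k+1},\\ x_{k+1}^{\rm ag}&=(1-\theta_k)x_k^{\rm ag}+\theta_kx_{k+1},\\ y_{k+1}^{\rm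 ag}&=(1-\theta_k)y_k^{\rm ag}+\theta_ky_{k+1}. \end{aligned}$$ For $\tilde z=(\tilde x,\tilde y)$ and $z=(x,y)$ in $\mathbb{R}^d\times Y$, $$Q(\tilde z,z)=[f(\tilde x)+\langle B\tilde x,y\rangle-g^*(y)]-[f(x)+\langle Bx,\tilde y\rangle-g^*(\tilde y)].$$ The partial primal-dual gap is $\mathcal{G}_{B_1\times B_2}(\tilde x,\tilde y)=\max_{z\in B_1\times B_2}Q((\tilde x,\tilde y),z)$, with $\max$ understood as supremum. A saddle point is a point $\hat z=(\hat x,\hat y)\in\mathbb{R}^d\times Y$ with $Q(\hat z,z)\le 0$ for all $z\in\mathbb{R}^d\times Y$ (equivalently $f(\hat x)+\langle B\hat x,y\rangle-g^*(y)\le f(\hat x)+\langle B\hat x,\hat y\rangle-g^*(\hat y)\le f(x)+\langle Bx,\hat y\rangle-g^*(\hat y)$ for all $x\in\mathbb{R}^d,y\in Y$). *)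

(* Defs.v *)
From HB Require Import structures.
From mathcomp Require Export all_boot all_order all_algebra.
From mathcomp Require Export all_classical all_reals all_analysis.
Export Order.TTheory GRing.Theory Num.Theory.
Export numFieldNormedType.Exports.

Set Implicit Arguments.
Unset Strict Implicit.
Unset Printing Implicit Defensive.

Local Open Scope classical_set_scope.
Local Open Scope ring_scope.

(* The library norm on matrices is the sup norm, hence [norm2]. *)
Definition dot (R : realType) (n : nat) (u v : 'cV[R]_n) : R :=
  \sum_(i < n) u i 0 * v i 0.

Definition norm2 (R : realType) (n : nat) (u : 'cV[R]_n) : R :=
  Num.sqrt (dot u u).

Definition grad (R : realType) (n : nat) (f : 'cV[R]_n -> R) (x : 'cV[R]_n) :
    'cV[R]_n :=
  \col_(i < n) 'D_(delta_mx i 0) f x.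

(* Largest eigenvalue; meant for symmetric A of size n > 0, whose real
   spectrum is finite and nonempty, so that the supremum is a maximum. *)
Definition rho_max (R : realType) (n : nat) (A : 'M[R]_n) : R :=
  sup [set a : R | eigenvalue A a].

Definition conjugate (R : realType) (n : nat) (g : 'cV[R]_n -> R)
    (y : 'cV[R]_n) : \bar R :=
  ereal_sup [set (dot x y - g x)%:E | x in [set: 'cV[R]_n]].

Definition edom (R : realType) (n : nat) (h : 'cV[R]_n -> \bar R) :
    set 'cV[R]_n :=
  [set y | (h y < +oo)%E].

Definition argmin (R : realType) (T : Type) (F : T -> \bar R) : set T :=
  [set s | forall t, (F s <= F t)%E].

(* Set-valued: for 0 < gamma and h proper, convex and l.s.c. it is the
   singleton of the usual proximal point. *)
Definition prox (R : realType) (n : nat) (gamma : R) (h : 'cV[R]_n -> \bar R)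
    (s : 'cV[R]_n) : set 'cV[R]_n :=
  argmin (fun y => (gamma%:E * h y + (2^-1 * norm2 (y - s) ^+ 2)%:E)%E).

(* The sequences are indexed from 1: nothing is said about their terms of
   index 0. *)
Record APDFP (R : realType) (d r : nat) (f : 'cV[R]_d -> R)
    (g : 'cV[R]_r -> R) (B : 'M[R]_(r, d)) (lambda : R) (gamma theta : nat -> R)
    (x : nat -> 'cV[R]_d) (y : nat -> 'cV[R]_r)
    (xag : nat -> 'cV[R]_d) (yag : nat -> 'cV[R]_r) : Prop := {
  APDFP_x1 : x 1%N = xag 1%N;
  APDFP_y1 : y 1%N = yag 1%N;
  APDFP_step : forall k : nat, (1 <= k)%N ->
    let xmd := (1 - theta k) *: xag k + theta k *: x k in
    let xbar := x k - (gamma k / theta k) *: grad f xmd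
                    - (gamma k / theta k) *: (B^T *m y k) in
    [/\ prox (lambda * theta k / gamma k) (conjugate g)
          ((lambda * theta k / gamma k) *: (B *m xbar) + y k) (y k.+1),
        x k.+1 = x k - (gamma k / theta k) *: grad f xmd
                     - (gamma k / theta k) *: (B^T *m y k.+1),
        xag k.+1 = (1 - theta k) *: xag k + theta k *: x k.+1 &
        yag k.+1 = (1 - theta k) *: yag k + theta k *: y k.+1] }.

Section primal_dual.
Variables (R : realType) (d r : nat).
Variables (f : 'cV[R]_d -> R) (g : 'cV[R]_r -> R) (B : 'M[R]_(r, d)).

Definition Lagr (x : 'cV[R]_d) (y : 'cV[R]_r) : \bar R :=
  ((f x + dot (B *m x) y)%:E - conjugate g y)%E.

(* Used for points whose second component lies in [edom (conjugate g)], where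
   all the terms are finite. *)
Definition Qgap (zt z : 'cV[R]_d * 'cV[R]_r) : \bar R :=
  (Lagr zt.1 z.2 - Lagr z.1 zt.2)%E.

Definition partial_gap (B1 : set 'cV[R]_d) (B2 : set 'cV[R]_r)
    (zt : 'cV[R]_d * 'cV[R]_r) : \bar R :=
  ereal_sup [set Qgap zt z | z in B1 `*` B2].

Definition saddle_point (zh : 'cV[R]_d * 'cV[R]_r) : Prop :=
  edom (conjugate g) zh.2 /\
  forall z, edom (conjugate g) z.2 -> (Qgap zh z <= 0)%E.

End primal_dual.

(* Main.v *)
Require Import Defs.
From mathcomp Require Import ring lra.

(** The argument follows the gap
    $q_k(z) = Q((x_k^{ag}, y_k^{ag}), z)$ for a fixed comparison point
    $z = (x, y)$ with $y$ in the domain of $g^*$. With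
    $M = I - \lambda B B^T$ and $|u|_M^2 = <M u, u>$, one step of the
    algorithm gives ([gap_step])
    $$q_{k+1} <= (1 - \theta_k) q_k
        + a_k (|x_k - x|^2 - |x_{k+1} - x|^2)
        + b_k (|y_k - y|_M^2 - |y_{k+1} - y|_M^2),$$
    where $a_k = \theta_k^2 / (2 \gamma_k)$ and
    $b_k = \gamma_k / (2 \lambda)$. The primal half is the descent lemma at
    $x_k^{md}$ ([accelerated_descent]); the dual half is the variational
    inequality of the proximal point ([prox_conjugate]), in which replacing
    $\bar x_k$ by $x_{k+1}$ produces the matrix $M$. Both weights
    $w = a$ and $w = b$ satisfy $(1 - \theta_{k+1}) w_k <= w_{k+1}$: that is
    exactly what the two ratio conditions on the step sizes say. Hence, as $\theta_1 = 1$ erases $q_1$,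
    induction gives $q_{k+1} <= a_k U + b_k V$ whenever $U$ and $V$ bound all
    the $|x_k - x|^2$ and all the $|y_k - y|_M^2$
    ([gap_recursion_bound]). No sign of $q_k$ is needed there, so the bound
    passes to the supremum over $B_1 \times B_2$, and $a_k$, $b_k$ are the
    coefficients of the announced rate.

    What remains is that $U$ and $V$ are finite. The dual iterates lie in the
    domain of $g^*$, which is bounded because $g$ is Lipschitz
    ([edom_conjugate_bounded]), and $|u|_M^2 <= \rho_{max}(M) |u|^2$ by
    the Rayleigh principle ([dot_le_rho_max]), which also gives $M >= 0$
    from the bound on $\lambda$. For the primal iterates, $z$ is taken to be a
    saddle point, so that $q_k >= 0$; dividing the recursion by $a_k$ makes
    the $x$ terms telescope with weight one, while the weights
    $b_k / a_k = \gamma_k^2 / (\lambda \theta_k^2)$ of the $y$ terms are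
    increasing and bounded ([distance_recursion_bound]). *)

Set Implicit Arguments.
Unset Strict Implicit.
Unset Printing Implicit Defensive.

Local Open Scope classical_set_scope.
Local Open Scope ring_scope.

(** * Euclidean inner product *)

Section dot_theory.
Variables (R : realType) (n : nat).
Implicit Types (u v w : 'cV[R]_n) (a : R).

Lemma dotC u v : dot u v = dot v u.
Proof. by apply: eq_bigr => i _; rewrite mulrC. Qed.

Lemma dotDl u v w : dot (u + v) w = dot u w + dot v w.
Proof. by rewrite -big_split; apply: eq_bigr => i _; rewrite mxE mulrDl. Qed.

Lemma dotZl a u v : dot (a *: u) v = a * dot u v.
Proof. by rewrite mulr_sumr; apply: eq_bigr => i _; rewrite mxE mulrA. Qed.

Lemma dotNl u v : dot (- u) v = - dot u v.
Proof. by rewrite -scaleN1r dotZl mulN1r. Qed.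

Lemma dotDr u v w : dot u (v + w) = dot u v + dot u w.
Proof. by rewrite dotC dotDl !(dotC u). Qed.

Lemma dotZr a u v : dot u (a *: v) = a * dot u v.
Proof. by rewrite dotC dotZl (dotC u). Qed.

Lemma dotNr u v : dot u (- v) = - dot u v.
Proof. by rewrite dotC dotNl (dotC u). Qed.

Definition dotE := (dotDl, dotDr, dotNl, dotNr, dotZl, dotZr).

Lemma dot0l u : dot 0 u = 0.
Proof. by rewrite -(scale0r u) dotZl mul0r. Qed.

Lemma dot_ge0 u : 0 <= dot u u.
Proof. by apply: sumr_ge0 => i _; rewrite -expr2 sqr_ge0. Qed.

Lemma dot_eq0 u : (dot u u == 0) = (u == 0).
Proof.
apply/eqP/eqP => [u0|->]; last by rewrite dot0l.
apply/matrixP => i j; rewrite ord1 mxE; apply/eqP.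
have /eqP := u0; rewrite psumr_eq0 => [/allP/(_ i)|k _]; last first.
  by rewrite -expr2 sqr_ge0.
by rewrite mem_index_enum /= -expr2 sqrf_eq0 => /(_ isT).
Qed.

Lemma norm2_sqr u : norm2 u ^+ 2 = dot u u.
Proof. by rewrite sqr_sqrtr ?dot_ge0. Qed.

Lemma norm2_ge0 u : 0 <= norm2 u.
Proof. exact: sqrtr_ge0. Qed.

Lemma dot_le_norm2 u v : dot u v <= norm2 u * norm2 v.
Proof.
have [v0|v0] := eqVneq (dot v v) 0.
  move/eqP: (v0); rewrite dot_eq0 => /eqP ->.
  by rewrite dotC dot0l mulr_ge0 ?norm2_ge0.
have vv : 0 < dot v v by rewrite lt_def v0 dot_ge0.
rewrite (le_trans (ler_norm _)) // -sqrtr_sqr /norm2 -sqrtrM ?dot_ge0 //.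
rewrite ler_wsqrtr // -(ler_pM2l vv) -subr_ge0.
have := dot_ge0 (dot v v *: u - dot u v *: v).
rewrite !dotE (dotC v u); congr (0 <= _); ring.
Qed.


(** Sets bounded for the sup norm [`|u|] of matrices are thereby bounded for
    the Euclidean norm. *)
Lemma dot_le_mx_norm u : dot u u <= n%:R * `|u| ^+ 2.
Proof.
rewrite mulr_natl -[X in _ *+ X]card_ord -sumr_const ler_sum // => i _.
rewrite -expr2 -real_normK ?num_real // lerXn2r ?nnegrE //.
rewrite [leRHS]/Num.norm /= mx_normrE.
by apply/bigmax_geP; right => /=; exists (i, 0).
Qed.

End dot_theory.

Lemma dot_mulmx (R : realType) (m n : nat) (A : 'M[R]_(m, n)) u v :
  dot (A *m u) v = dot u (A^T *m v).
Proof.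
rewrite /dot; under eq_bigr => i _ do rewrite mxE mulr_suml.
rewrite exchange_big; apply: eq_bigr => j _; rewrite mxE mulr_sumr.
by apply: eq_bigr => i _; rewrite mxE; ring.
Qed.

(** * Rayleigh principle for symmetric matrices *)

(** Letting [t] tend to $0^+$ turns a first-order perturbation argument into
    an inequality; this form needs no differentiability of the perturbed
    quantity. *)
Lemma le_of_le_addt (R : realFieldType) (a b c : R) :
  (forall t, 0 < t -> t <= 1 -> a <= b + t * c) -> a <= b.
Proof.
move=> H; rewrite leNgt; apply/negP => ltba.
have c0 : 0 < `|c| + 1 by rewrite ltr_wpDl.
pose t := Num.min 1 ((a - b) / (`|c| + 1) / 2).
have t0 : 0 < t by rewrite lt_min ltr01 !divr_gt0 ?subr_gt0.
have := H t t0; rewrite ge_min lexx => /(_ isT); apply/negP; rewrite -ltNge.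
have h2 : t * (`|c| + 1) <= (a - b) / 2.
  have : t <= (a - b) / (`|c| + 1) / 2 by rewrite ge_min lexx orbT.
  by rewrite -(ler_pM2r c0) => /le_trans; apply; rewrite mulrAC divfK ?gt_eqF.
have h1 : t * c <= t * (`|c| + 1).
  by rewrite ler_pM2l // (le_trans (ler_norm c)) // lerDl.
lra.
Qed.

Section rayleigh.
Variables (R : realType) (n : nat) (A : 'M[R]_n).

Lemma continuous_quadratic :
  continuous (fun w : 'rV[R]_n => dot (A *m w^T) w^T).
Proof.
have ct j : continuous (fun w : 'rV[R]_n => w^T j 0).
  rewrite (_ : (fun w => _) = (fun w : 'rV[R]_n => w 0 j)).
    exact: coord_continuous.
  by apply/funext => w; rewrite mxE.
apply: continuous_big; first exact: add_continuous.
move=> i _ w; apply: continuousM; last exact: ct.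
rewrite (_ : (fun w => _) =
    (fun w : 'rV[R]_n => \sum_(j < n) A i j * w^T j 0)); last first.
  by apply/funext => u; rewrite mxE.
move: w; apply: continuous_big; first exact: add_continuous.
by move=> j _ w; apply: continuousM; [exact: cst_continuous|exact: ct].
Qed.
End rayleigh.

Section rayleigh_max.
Variables (R : realType) (n : nat).
Implicit Types (A : 'M[R]_n) (v : 'cV[R]_n).

Lemma compact_sphere : compact [set w : 'rV[R]_n | dot w^T w^T = 1].
Proof.
apply: bounded_closed_compact.
  exists 1; split => // M M1 w /= w1; rewrite (le_trans _ (ltW M1)) //.
  rewrite [leLHS]/Num.norm /= mx_normrE; apply/bigmax_leP; split => // -[i j] _.
  rewrite ord1 /= -(@expr_le1 _ 2) // real_normK ?num_real // -w1.
  rewrite /dot (bigD1 j) //= !mxE -expr2 lerDl sumr_ge0 // => k _.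
  by rewrite -expr2 sqr_ge0.
rewrite (_ : mkset _ = (fun w : 'rV[R]_n => dot (1%:M *m w^T) w^T) @^-1` [set 1]).
  by apply: preimage_closed; [move=> w _; exact: continuous_quadratic|exact: closed_eq].
by apply/seteqP; split => w /=; rewrite mul1mx.
Qed.

(** The form $u \mapsto m |u|^2 - <A u, u>$ is nonnegative and vanishes at [v],
    so its gradient [m v - A v] vanishes as well. *)
Lemma rayleigh_eigenvector A m v : A^T = A ->
  (forall u, dot (A *m u) u <= m * dot u u) ->
  dot (A *m v) v = m * dot v v -> A *m v = m *: v.
Proof.
move=> sA qA qv; have [e Av] : exists e, A *m v = m *: v - e.
  by exists (m *: v - A *m v); rewrite subKr.
suff : dot e e <= 0.
  by rewrite le_eqVlt ltNge dot_ge0 orbF dot_eq0 Av => /eqP ->; rewrite subr0.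
suff : 2 * dot e e <= 0 by rewrite pmulr_rle0.
apply: (@le_of_le_addt _ _ _ (m * dot e e - dot (A *m e) e)) => t t0 _.
have := qA (v - t *: e); rewrite mulmxBr -scalemxAr !dotE qv.
rewrite [dot (A *m e) v]dot_mulmx sA Av !dotE (dotC v e) => H.
rewrite -(ler_pM2l t0); nra.
Qed.

(** The maximum of the Rayleigh quotient over the unit sphere is an
    eigenvalue, and it bounds all the others. *)
Lemma dot_le_rho_max A v : A^T = A ->
  dot (A *m v) v <= rho_max A * dot v v.
Proof.
move=> sA; have [->|v0] := eqVneq v 0; first by rewrite dotC !dot0l mulr0.
have unit_normalize (u : 'cV[R]_n) : u != 0 -> exists2 s, s ^+ 2 * dot u u = 1 & s != 0.
  move=> u0; have uu0 : 0 < dot u u by rewrite lt_def dot_ge0 dot_eq0 u0.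
  exists (norm2 u)^-1; first by rewrite exprVn norm2_sqr mulVf // gt_eqF.
  by rewrite invr_eq0 -sqrf_eq0 norm2_sqr gt_eqF.
have [|c] := compact_EVT_max _ compact_sphere
    (continuous_subspaceT (@continuous_quadratic R n A)).
  have [s sv _] := unit_normalize v v0; exists (s *: v^T) => /=.
  by rewrite linearZ /= trmxK !dotE mulrA.
rewrite inE /= => c1 cmax; set m := dot (A *m c^T) c^T in cmax.
have qA u : dot (A *m u) u <= m * dot u u.
  have [->|u0] := eqVneq u 0; first by rewrite dotC !dot0l mulr0.
  have [s su s0] := unit_normalize u u0.
  have := cmax (s *: u^T); rewrite inE /= linearZ /= trmxK -scalemxAr !dotE.
  rewrite !mulrA -expr2 => /(_ su) H.
  have s2 : 0 < s ^+ 2 by rewrite lt_def sqrf_eq0 s0 sqr_ge0.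
  by rewrite -(ler_pM2l s2) (le_trans H) // mulrCA su mulr1.
have eig_m : eigenvalue A m.
  apply/eigenvalueP; exists c; last first.
    by apply: contraPneq c1 => ->; rewrite trmx0 dot0l => /esym/eqP; rewrite oner_eq0.
  apply: trmx_inj; rewrite trmx_mul sA linearZ /=.
  by apply: rayleigh_eigenvector => //; rewrite c1 mulr1.
apply: (le_trans (qA v)); rewrite ler_wpM2r ?dot_ge0 //.
apply: ub_le_sup => //; exists m => a /= /eigenvalueP[w wA w0].
have wt0 : 0 < dot w^T w^T.
  by rewrite lt_def dot_ge0 dot_eq0 andbT -trmx0 (inj_eq trmx_inj).
rewrite -(ler_pM2r wt0) (le_trans _ (qA _)) //.
by rewrite -[A in leRHS]sA -trmx_mul wA linearZ /= dotZl.
Qed.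
End rayleigh_max.

(** * Convex functions with Lipschitz gradient *)

Lemma convex_functionW (R : realType) (n : nat) (f : 'cV[R]_n -> R) :
  convex_function [set: 'cV[R]_n] f -> forall x y t, 0 <= t -> t <= 1 ->
  f (t *: x + (1 - t) *: y) <= t * f x + (1 - t) * f y.
Proof.
move=> cf x y t t0 t1; have := cf (Itv01 t0 t1) x y.
by rewrite !inE => /(_ Logic.I Logic.I).
Qed.

Section smooth.
Variables (R : realType) (n : nat) (f : 'cV[R]_n -> R).
Hypothesis f_diff : forall x, differentiable f x.

Lemma diff_grad x h : 'd f x h = dot (grad f x) h.
Proof.
have {1}-> : h = \sum_i h i 0 *: delta_mx i 0.
  by rewrite {1}[h]matrix_sum_delta; apply: eq_bigr => i _; rewrite big_ord1.
rewrite linear_sum; apply: eq_bigr => i _.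
by rewrite linearZ /= mxE deriveE // mulrC.
Qed.

Lemma is_derive_line x h (t : R) :
  is_derive t 1 (fun s => f (x + s *: h)) (dot (grad f (x + t *: h)) h).
Proof.
have e : (fun s : R => s^-1 *: (f (x + (s *: 1 + t) *: h) - f (x + t *: h))) =
    (fun s : R => s^-1 *: (f (s *: h + (x + t *: h)) - f (x + t *: h))).
  apply/funext => s; congr (_ *: (f _ - _)).
  by rewrite [s *: 1]mulr1 scalerDl addrCA.
apply: DeriveDef; rewrite /derivable /derive /= e.
  exact: (diff_derivable (f_diff _)).
by rewrite -diff_grad -deriveE.
Qed.

Variable L : R.
Hypothesis f_lip :
  forall x x', norm2 (grad f x - grad f x') <= L * norm2 (x - x').

Lemma grad_line_le x h t : 0 <= t ->
  `|dot (grad f (x + t *: h) - grad f x) h| <= L * t * dot h h.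
Proof.
move=> t0; have nZ : norm2 (t *: h) = t * norm2 h.
  by rewrite /norm2 !dotE mulrA -expr2 sqrtrM ?sqr_ge0 // sqrtr_sqr ger0_norm.
have H : norm2 (grad f (x + t *: h) - grad f x) * norm2 h <= L * t * dot h h.
  rewrite -norm2_sqr expr2 mulrA ler_wpM2r ?norm2_ge0 // -mulrA -nZ.
  by rewrite (le_trans (f_lip _ _)) // addrAC subrr add0r.
rewrite ler_norml; apply/andP; split; last exact: le_trans (dot_le_norm2 _ _) H.
rewrite lerNl -dotNl (le_trans (dot_le_norm2 _ _)) // (le_trans _ H) //.
by rewrite /norm2 dotNl dotNr opprK.
Qed.

(** The mean value theorem for
    $t \mapsto f(x + t h) - t <\nabla f(x), h> - L t^2 |h|^2 / 2$, whose
    derivative is nonpositive for $t >= 0$ because the gradient is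
    $L$-Lipschitz. The two-sided form also gives the lower estimate from which
    [gradient_inequality] is derived. *)
Lemma descent x h :
  `|f (x + h) - f x - dot (grad f x) h| <= L / 2 * dot h h.
Proof.
(* The sign [s] treats [f] and [- f] together. *)
have bound (s : R) : `|s| = 1 ->
    s * (f (x + h) - f x - dot (grad f x) h) <= L / 2 * dot h h.
  move=> s1.
  pose phi : R -> R := s \*: (fun t : R => f (x + t *: h)) -
    ((s * dot (grad f x) h) \*: (id : R -> R)) -
    ((L / 2 * dot h h) \*: ((id : R -> R) ^+ 2)).
  pose dphi t := s * dot (grad f (x + t *: h)) h - s * dot (grad f x) h
    - L * dot h h * t.
  have dphiE (t : R) : is_derive t (1 : R) phi (dphi t).
    have := is_derive_line x h t => ?.
    by apply: is_derive_eq; rewrite /dphi /GRing.scale /=; field.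
  have phi_cont : {within `[0, 1], continuous phi}.
    by apply: derivable_within_continuous => t _; exact: ex_derive.
  have [t t01] := MVT ltr01 (fun t _ => dphiE t) phi_cont.
  have t0 : 0 <= t by move: t01; rewrite in_itv /= => /andP[/ltW].
  have phiE u : phi u = s * f (x + u *: h) - s * dot (grad f x) h * u
      - L / 2 * dot h h * u ^+ 2 by [].
  rewrite !phiE subr0 mulr1 scale1r scale0r addr0 /dphi => e.
  have : s * dot (grad f (x + t *: h) - grad f x) h <= L * t * dot h h.
    by rewrite (le_trans (ler_norm _)) // normrM s1 mul1r grad_line_le.
  rewrite dotDl dotNl; lra.
rewrite ler_norml; apply/andP; split.
  by have := bound (-1); rewrite normrN1 => /(_ erefl); lra.
by have := bound 1; rewrite normr1 mul1r => /(_ erefl).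
Qed.

Hypothesis f_convex : convex_function [set: 'cV[R]_n] f.

(** Along the segment from [x] to [y], [f] lies below its chord by convexity
    and above its tangent up to $O(t^2)$ by [descent]; compare the slopes as
    $t \to 0^+$. *)
Lemma gradient_inequality x y : f x + dot (grad f x) (y - x) <= f y.
Proof.
apply: (@le_of_le_addt _ _ _ (L / 2 * dot (y - x) (y - x))) => t t0 t1.
have := descent x (t *: (y - x)); rewrite ler_norml => /andP[+ _].
have := convex_functionW f_convex y x (ltW t0) t1.
have -> : t *: y + (1 - t) *: x = x + t *: (y - x).
  by rewrite scalerBl scale1r scalerBr addrC -addrA [- _ + _]addrC.
rewrite !(dotZl, dotZr) => H1 H2; rewrite -(ler_pM2l t0); lra.
Qed.

End smooth.

(** * Convex conjugate and its proximal point *)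

Section conjugate.
Variables (R : realType) (n : nat) (g : 'cV[R]_n -> R).
Implicit Types (x y p s : 'cV[R]_n).

Definition fconj y : R := fine (conjugate g y).

Lemma conjugate_fineE y : edom (conjugate g) y -> conjugate g y = (fconj y)%:E.
Proof.
rewrite /edom /= => gy; rewrite /fconj fineK // fin_numElt gy andbT.
rewrite (lt_le_trans (ltNyr (dot 0 y - g 0))) //.
by apply: ereal_sup_ubound; exists 0.
Qed.

Lemma fenchel_young y x : edom (conjugate g) y -> dot x y - g x <= fconj y.
Proof.
move=> gy; rewrite -lee_fin -conjugate_fineE //.
by apply: ereal_sup_ubound; exists x.
Qed.

Lemma fconj_le y M : (forall x, dot x y - g x <= M) ->
  edom (conjugate g) y /\ fconj y <= M.
Proof.
move=> H; have gyM : (conjugate g y <= M%:E)%E.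
  by apply: ge_ereal_sup => _ [x _ <-]; rewrite lee_fin.
have gy : edom (conjugate g) y by exact: le_lt_trans gyM (ltry M).
by split=> //; rewrite -lee_fin -conjugate_fineE.
Qed.

Lemma fconj_convex t y y' : 0 <= t -> t <= 1 ->
  edom (conjugate g) y -> edom (conjugate g) y' ->
  edom (conjugate g) (t *: y + (1 - t) *: y') /\
  fconj (t *: y + (1 - t) *: y') <= t * fconj y + (1 - t) * fconj y'.
Proof.
move=> t0 t1 gy gy'; apply: fconj_le => x; rewrite !dotE.
have := fenchel_young x gy; have := fenchel_young x gy'; nra.
Qed.

(** Far out on the ray spanned by [y], the pairing with [y] grows with slope
    $|y|$ per unit length and [g] with slope at most [L]; a finite supremum of
    the difference forces $|y| <= L$. *)
Lemma edom_conjugate_bounded L y :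
  (forall x x', `|g x - g x'| <= L * norm2 (x - x')) ->
  edom (conjugate g) y -> dot y y <= L ^+ 2.
Proof.
move=> g_lip gy.
have H : dot y y <= L * norm2 y.
  apply: (@le_of_le_addt _ _ _ (fconj y + g 0)) => t t0 _.
  have := fenchel_young (t^-1 *: y) gy.
  have := g_lip (t^-1 *: y) 0; rewrite subr0 => /(le_trans (ler_norm _)).
  have -> : norm2 (t^-1 *: y) = t^-1 * norm2 y.
    rewrite /norm2 !dotE mulrA -expr2 sqrtrM ?sqr_ge0 // sqrtr_sqr.
    by rewrite ger0_norm // invr_ge0 ltW.
  rewrite dotZl => H1 H2; have tt : t * t^-1 = 1 by rewrite divff ?gt_eqF.
  have : t * (t^-1 * dot y y) <= t * (t^-1 * (L * norm2 y) + (fconj y + g 0)).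
    by rewrite ler_pM2l //; lra.
  by rewrite mulrDr !mulrA tt !mul1r.
have n0 := norm2_ge0 y; move: H; rewrite -norm2_sqr => H.
have [->|ny] := eqVneq (norm2 y) 0; first by rewrite expr0n sqr_ge0.
have n1 : 0 < norm2 y by rewrite lt_def ny.
have : norm2 y <= L by rewrite -(ler_pM2r n1) -expr2.
by move=> H1; rewrite lerXn2r // nnegrE // (le_trans n0).
Qed.

(** The variational inequality of the proximal point: moving from the
    minimiser [p] towards [y] cannot decrease the objective, whose quadratic
    part has slope [dot (p - s) (y - p)] at [p]. *)
Lemma prox_conjugate sigma s p : 0 < sigma -> prox sigma (conjugate g) s p ->
  edom (conjugate g) !=set0 ->
  edom (conjugate g) p /\
  forall y, edom (conjugate g) y ->
    sigma * (fconj p - fconj y) <= dot (s - p) (p - y).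
Proof.
move=> sg0 pmin [y0 gy0].
have gp : edom (conjugate g) p.
  rewrite /edom /= ltNge leye_eq; apply/eqP => gpy.
  have := pmin y0; rewrite gpy (conjugate_fineE gy0) -EFinM -EFinD.
  by rewrite gt0_muley ?lte_fin // addye // leye_eq.
split=> // y gy; apply: (@le_of_le_addt _ _ _ (2^-1 * dot (y - p) (y - p))).
move=> t t0 t1; have [gt Ht] := fconj_convex (ltW t0) t1 gy gp.
have := pmin (t *: y + (1 - t) *: p).
rewrite !conjugate_fineE // -!EFinM -!EFinD lee_fin !norm2_sqr.
have -> : t *: y + (1 - t) *: p - s = (p - s) + t *: (y - p).
  by apply/matrixP => i j; rewrite !mxE; ring.
have -> : s - p = - (p - s) by rewrite opprB.
have -> : p - y = - (y - p) by rewrite opprB.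
move: (p - s) (y - p) => u v; rewrite !dotE (dotC v u) => H.
rewrite -(ler_pM2l t0).
have : sigma * fconj (t *: y + (1 - t) *: p) <=
  sigma * (t * fconj y + (1 - t) * fconj p) by rewrite ler_pM2l.
lra.
Qed.

End conjugate.

(** * One step of the algorithm *)

Lemma dot_mulmx_sym (R : realType) (n : nat) (A : 'M[R]_n) (u v : 'cV[R]_n) :
  A^T = A -> dot (A *m u) v = dot (A *m v) u.
Proof. by move=> sA; rewrite dot_mulmx sA dotC. Qed.

(** The identity that makes the squared distances to [c] telescope. *)
Lemma three_points (R : realType) (n : nat) (A : 'M[R]_n) (a b c : 'cV[R]_n) :
  A^T = A ->
  dot (A *m (a - b)) (b - c) = 2^-1 * (dot (A *m (a - c)) (a - c)
    - dot (A *m (b - c)) (b - c) - dot (A *m (a - b)) (a - b)).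
Proof.
move=> sA; have -> : a - c = (a - b) + (b - c) by rewrite addrA subrK.
move: (a - b) (b - c) => u v; rewrite mulmxDr !dotE (dot_mulmx_sym v u sA).
by field.
Qed.

Section one_step.
Variables (R : realType) (d r : nat).
Variables (f : 'cV[R]_d -> R) (g : 'cV[R]_r -> R) (B : 'M[R]_(r, d)).
Variables (L lambda : R).
Hypothesis f_convex : convex_function [set: 'cV[R]_d] f.
Hypothesis f_diff : forall x : 'cV[R]_d, differentiable f x.
Hypothesis L_gt0 : 0 < L.
Hypothesis f_lip : forall x x' : 'cV[R]_d,
  norm2 (grad f x - grad f x') <= L * norm2 (x - x').
Hypothesis lambda_gt0 : 0 < lambda.

(** The dual steps are measured in the seminorm of this matrix: it is what is
    left of the identity once the explicit $\bar x_k$ in the dual update is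
    traded for the implicit $x_{k+1}$. *)
Definition precond : 'M[R]_r := 1%:M - lambda *: (B *m B^T).

Lemma precond_sym : precond^T = precond.
Proof. by rewrite /precond linearB linearZ /= trmx1 trmx_mul trmxK. Qed.

Hypothesis precond_ge0 : forall u, 0 <= dot (precond *m u) u.

(** The real-valued form of $Q$, meaningful where both dual points lie in the
    domain of the conjugate. *)
Definition gap (xt : 'cV[R]_d) (yt : 'cV[R]_r) (x : 'cV[R]_d) (y : 'cV[R]_r) :=
  f xt + dot (B *m xt) y - fconj g y - (f x + dot (B *m x) yt - fconj g yt).

(** The descent lemma at $x^{md}$ with the increment
    $\theta (x' - x_k)$, after which the tangent at $x^{md}$ is bounded by [f]
    at $x^{ag}$ with weight $1 - \theta$ and at [x] with weight $\theta$. *)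
Lemma accelerated_descent (xag xk xmd x' x : 'cV[R]_d) theta :
  0 <= theta -> theta <= 1 -> xmd = (1 - theta) *: xag + theta *: xk ->
  f ((1 - theta) *: xag + theta *: x') <=
    (1 - theta) * f xag + theta * f x + theta * dot (grad f xmd) (x' - x)
    + L / 2 * theta ^+ 2 * dot (x' - xk) (x' - xk).
Proof.
move=> t0 t1 xmdE.
have -> : (1 - theta) *: xag + theta *: x' = xmd + theta *: (x' - xk).
  by rewrite xmdE; apply/matrixP => i j; rewrite !mxE; ring.
have := descent f_diff f_lip xmd (theta *: (x' - xk)).
move=> /(le_trans (ler_norm _)); rewrite !(dotZl (theta)) !(dotZr theta) => H.
have grad_ineq u : f xmd + dot (grad f xmd) (u - xmd) <= f u.
  exact: (gradient_inequality f_diff f_lip f_convex).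
have e : dot (grad f xmd) (x' - xk) * theta =
    (1 - theta) * dot (grad f xmd) (xag - xmd) + theta * dot (grad f xmd) (x - xmd)
    + theta * dot (grad f xmd) (x' - x).
  by move: (grad f _) => G; rewrite xmdE !dotE; ring.
have H1 : (1 - theta) * (f xmd + dot (grad f xmd) (xag - xmd)) <=
    (1 - theta) * f xag by rewrite ler_wpM2l ?subr_ge0.
have H2 : theta * (f xmd + dot (grad f xmd) (x - xmd)) <= theta * f x.
  by rewrite ler_wpM2l.
lra.
Qed.

(** The bilinear terms produced by the primal and the dual half cancel, because
    both are evaluated at the new pair $(x_{k+1}, y_{k+1})$. The remaining
    squared steps have the right sign: $|x_{k+1} - x_k|^2$ since
    $\gamma <= 1 / L$ and $|y_{k+1} - y_k|_M^2$ since $M >= 0$.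
    The alternative on [yag] covers the first step, where $\theta = 1$ and
    the starting point may lie outside the domain of the conjugate. *)
Lemma gap_step theta gamma (xag xk x1 x : 'cV[R]_d) (yag yk y1 y : 'cV[R]_r) :
  0 < theta -> theta <= 1 -> 0 < gamma -> gamma <= 1 / L ->
  let xmd := (1 - theta) *: xag + theta *: xk in
  let xbar := xk - (gamma / theta) *: grad f xmd
                 - (gamma / theta) *: (B^T *m yk) in
  prox (lambda * theta / gamma) (conjugate g)
    ((lambda * theta / gamma) *: (B *m xbar) + yk) y1 ->
  x1 = xk - (gamma / theta) *: grad f xmd - (gamma / theta) *: (B^T *m y1) ->
  theta = 1 \/ edom (conjugate g) yag ->
  edom (conjugate g) y ->
  gap ((1 - theta) *: xag + theta *: x1) ((1 - theta) *: yag + theta *: y1) x y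
  <= (1 - theta) * gap xag yag x y
    + theta ^+ 2 / (2 * gamma) * (dot (xk - x) (xk - x) - dot (x1 - x) (x1 - x))
    + gamma / (2 * lambda) * (dot (precond *m (yk - y)) (yk - y)
                              - dot (precond *m (y1 - y)) (y1 - y)).
Proof.
move=> t0 t1 ga0 gaL xmd xbar y1prox x1E yagP gy.
set sigma := lambda * theta / gamma in y1prox.
have sg0 : 0 < sigma by rewrite !mulr_gt0 // invr_gt0.
have [gy1 /(_ y gy) H_dual] := prox_conjugate sg0 y1prox (ex_intro _ y gy).
have fenchel : fconj g ((1 - theta) *: yag + theta *: y1) <=
    (1 - theta) * fconj g yag + theta * fconj g y1.
  case: yagP => [->|gyag].
    by rewrite subrr scale0r add0r scale1r mul0r add0r mul1r.
  have [||_] := fconj_convex (t := 1 - theta) _ _ gyag gy1.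
  - by rewrite subr_ge0.
  - by rewrite gerBl ltW.
  by rewrite opprB addrCA subrr addr0.
have H_primal := accelerated_descent x1 x (ltW t0) t1 (erefl xmd).
(* Rewriting $\bar x_k$ as $x_{k+1} - (\gamma / \theta) B^T (y_k - y_{k+1})$
   turns the identity acting on $y_k - y_{k+1}$ into $M$. *)
have residual : sigma *: (B *m xbar) + yk - y1 =
    precond *m (yk - y1) + sigma *: (B *m x1).
  have -> : xbar = x1 - (gamma / theta) *: (B^T *m (yk - y1)).
    rewrite x1E /xbar; move: (grad f xmd) => G; rewrite mulmxBr.
    by apply/matrixP => i j; rewrite !mxE; ring.
  rewrite /precond mulmxBl mul1mx mulmxBr -!scalemxAl -!scalemxAr mulmxA scalerBr.
  rewrite scalerA [_ * (gamma / theta)](_ : _ = lambda); last first.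
    by rewrite /sigma; field; rewrite !gt_eqF.
  by apply/matrixP => i j; rewrite !mxE; ring.
(* The primal update is solved for the gradient. *)
have grad_dot : theta * dot (grad f xmd) (x1 - x) =
    theta ^+ 2 / (2 * gamma) * (dot (xk - x) (xk - x) - dot (x1 - x) (x1 - x)
      - dot (x1 - xk) (x1 - xk)) - theta * dot (B *m (x1 - x)) y1.
  have -> : grad f xmd = (theta / gamma) *: (xk - x1) - B^T *m y1.
    rewrite x1E; move: (grad f xmd) => G; apply/matrixP => i j; rewrite !mxE.
    by field; rewrite !gt_eqF.
  rewrite [dot (_ *: _ - _) _]dotDl dotNl dotZl [dot (B *m _) y1]dot_mulmx.
  rewrite (dotC _ (B^T *m y1)).
  have := @three_points _ _ 1%:M xk x1 x (trmx1 _ _); rewrite !mul1mx => ->.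
  have -> : dot (x1 - xk) (x1 - xk) = dot (xk - x1) (xk - x1).
    by rewrite -opprB dotNl dotNr opprK.
  by field; rewrite gt_eqF.
rewrite residual dotDl dotZl (three_points _ _ _ precond_sym) in H_dual.
set P0 := dot (precond *m (yk - y)) _ in H_dual *.
set P1 := dot (precond *m (y1 - y)) _ in H_dual *.
have {}H_dual : theta * (fconj g y1 - fconj g y) <=
    theta * dot (B *m x1) (y1 - y) + gamma / (2 * lambda) * (P0 - P1).
  have P2_ge0 := precond_ge0 (yk - y1).
  rewrite -(ler_pM2l (divr_gt0 lambda_gt0 ga0)).
  have -> : lambda / gamma * (theta * dot (B *m x1) (y1 - y) +
      gamma / (2 * lambda) * (P0 - P1)) =
      2^-1 * (P0 - P1) + sigma * dot (B *m x1) (y1 - y).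
    by rewrite /sigma; field; rewrite !gt_eqF.
  rewrite mulrA [lambda / gamma * theta]mulrAC -/sigma (le_trans H_dual) //.
  rewrite lerD2r ler_pM2l ?invr_gt0 //; lra.
have step_small : L / 2 * theta ^+ 2 * dot (x1 - xk) (x1 - xk) <=
    theta ^+ 2 / (2 * gamma) * dot (x1 - xk) (x1 - xk).
  rewrite ler_wpM2r ?dot_ge0 // mulrC ler_wpM2l ?sqr_ge0 // invfM mulrC.
  rewrite ler_wpM2l ?invr_ge0 // -(ler_pM2r ga0) mulVf ?gt_eqF // mulrC.
  by rewrite -ler_pdivlMr.
have bil_primal : dot (B *m ((1 - theta) *: xag + theta *: x1)) y =
    (1 - theta) * dot (B *m xag) y + theta * dot (B *m x1) y.
  by rewrite mulmxDr -!scalemxAr !dotE.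
have bil_dual : dot (B *m x) ((1 - theta) *: yag + theta *: y1) =
    (1 - theta) * dot (B *m x) yag + theta * dot (B *m x) y1 by rewrite !dotE.
rewrite mulmxBr [dot (B *m _ - _) _]dotDl dotNl in grad_dot.
rewrite dotDr dotNr in H_dual.
rewrite /gap bil_primal bil_dual; lra.
Qed.
End one_step.

(** * Recursions satisfied by the gap *)

Section gap_recursion.
Variables (R : realFieldType) (theta a b Q X Y : nat -> R).
Hypothesis theta1 : theta 1%N = 1.
Hypothesis theta_le1 : forall k, (1 <= k)%N -> theta k <= 1.
Hypothesis a_gt0 : forall k, (1 <= k)%N -> 0 < a k.
Hypothesis b_ge0 : forall k, (1 <= k)%N -> 0 <= b k.
Hypothesis a_decr : forall k, (1 <= k)%N -> (1 - theta k.+1) * a k <= a k.+1.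
Hypothesis b_decr : forall k, (1 <= k)%N -> (1 - theta k.+1) * b k <= b k.+1.
Hypothesis Q_rec : forall k, (1 <= k)%N ->
  Q k.+1 <= (1 - theta k) * Q k + a k * (X k - X k.+1) + b k * (Y k - Y k.+1).

(** The terms [X k.+1] and [Y k.+1] are kept in the induction: since the weights
    [a] and [b] change with the index, the sum telescopes only against the
    upper bounds [U] and [V]. *)
Lemma gap_recursion_bound U V :
  (forall k, (1 <= k)%N -> 0 <= X k <= U) ->
  (forall k, (1 <= k)%N -> 0 <= Y k <= V) ->
  forall k, (1 <= k)%N -> Q k.+1 <= a k * U + b k * V.
Proof.
move=> XU YV k k1.
suff H : Q k.+1 <= a k * (U - X k.+1) + b k * (V - Y k.+1).
  have /andP[X0 _] := XU k.+1 isT; have /andP[Y0 _] := YV k.+1 isT.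
  have := mulr_ge0 (ltW (a_gt0 k1)) X0; have := mulr_ge0 (b_ge0 k1) Y0; lra.
elim: k k1 => // -[_ _|k /(_ isT) IH _].
  have := Q_rec (leqnn 1); rewrite theta1 subrr mul0r add0r.
  have /andP[_ X1] := XU 1%N isT; have /andP[_ Y1] := YV 1%N isT.
  move=> /le_trans; apply; apply: lerD.
  - by rewrite ler_pM2l ?a_gt0 // lerD2r.
  - by rewrite ler_wpM2l ?b_ge0 // lerD2r.
have /andP[_ X1] := XU k.+2 isT; have /andP[_ Y1] := YV k.+2 isT.
have H0 : (1 - theta k.+2) * Q k.+2 <= (1 - theta k.+2) *
    (a k.+1 * (U - X k.+2) + b k.+1 * (V - Y k.+2)).
  by rewrite ler_wpM2l // subr_ge0 theta_le1.
have Ha : (1 - theta k.+2) * a k.+1 * (U - X k.+2) <= a k.+2 * (U - X k.+2).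
  by rewrite ler_wpM2r ?subr_ge0 // a_decr.
have Hb : (1 - theta k.+2) * b k.+1 * (V - Y k.+2) <= b k.+2 * (V - Y k.+2).
  by rewrite ler_wpM2r ?subr_ge0 // b_decr.
have := Q_rec (isT : (1 <= k.+2)%N); lra.
Qed.

(** When the gap is nonnegative it can be dropped once the recursion is divided
    by [a k]; the increments of [X] then telescope without weights. *)
Lemma distance_recursion_bound C V :
  (forall k, (2 <= k)%N -> 0 <= Q k) ->
  (forall k, (1 <= k)%N -> b k / a k <= b k.+1 / a k.+1 <= C) ->
  (forall k, (1 <= k)%N -> 0 <= Y k <= V) ->
  forall k, (1 <= k)%N -> X k.+1 <= X 1%N + C * V.
Proof.
move=> Q0 ba YV k k1.
suff H : Q k.+1 / a k + X k.+1 <= X 1%N + b k / a k * (V - Y k.+1).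
  have /andP[Y0 _] := YV k.+1 isT; have /andP[Y10 Y1] := YV 1%N isT.
  have /andP[bak bak'] := ba k k1.
  have ba0 : 0 <= b k / a k by rewrite divr_ge0 ?b_ge0 // ltW ?a_gt0.
  have V0 : 0 <= V by exact: le_trans Y1.
  have : b k / a k * V <= C * V by rewrite ler_wpM2r // (le_trans bak).
  have := mulr_ge0 ba0 Y0.
  have : 0 <= Q k.+1 / a k by rewrite divr_ge0 ?Q0 // ltW ?a_gt0.
  lra.
have Q_rec' j : (1 <= j)%N -> Q j.+1 / a j <=
    (1 - theta j) * Q j / a j + (X j - X j.+1) + b j / a j * (Y j - Y j.+1).
  move=> j1; have aj := a_gt0 j1; rewrite ler_pdivrMr // (le_trans (Q_rec j1)) //.
  by rewrite le_eqVlt; apply/orP; left; apply/eqP; field; rewrite gt_eqF.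
elim: k k1 => // -[_ _|k /(_ isT) IH _].
  have := Q_rec' _ (leqnn 1); rewrite theta1 subrr !mul0r add0r.
  have /andP[_ Y1] := YV 1%N isT.
  have : b 1%N / a 1%N * (Y 1%N - Y 2) <= b 1%N / a 1%N * (V - Y 2).
    by rewrite ler_wpM2l ?divr_ge0 ?b_ge0 ?lerD2r // ltW ?a_gt0.
  lra.
have /andP[_ Y1] := YV k.+2 isT; have /andP[ba1 _] := ba k.+1 isT.
have Hb : b k.+1 / a k.+1 * (V - Y k.+2) <= b k.+2 / a k.+2 * (V - Y k.+2).
  by rewrite ler_wpM2r // subr_ge0.
have HQ : (1 - theta k.+2) * Q k.+2 / a k.+2 <= Q k.+2 / a k.+1.
  rewrite ler_pdivrMr ?a_gt0 // mulrAC ler_pdivlMr ?a_gt0 //.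
  by rewrite mulrAC mulrC ler_wpM2l ?Q0 // a_decr.
have := Q_rec' k.+2 isT; lra.
Qed.

End gap_recursion.

Section bounded_distances.
Variables (R : realType) (n : nat).
Implicit Types u v : 'cV[R]_n.

Lemma dot_sub_le u v : dot (u - v) (u - v) <= 2 * dot u u + 2 * dot v v.
Proof. by have := dot_ge0 (u + v); rewrite !dotE (dotC v u); lra. Qed.

Lemma bounded_set_dot (S : set 'cV[R]_n) : bounded_set S ->
  exists N, forall v, S v -> dot v v <= N.
Proof.
move=> /pinfty_ex_gt0[M M0 SM]; exists (n%:R * M ^+ 2) => v /SM /= vM.
rewrite (le_trans (dot_le_mx_norm v)) // ler_wpM2l // lerXn2r ?nnegrE //.
exact: ltW.
Qed.

(** The bound depends on the set only, so that it can be chosen before the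
    other factor of $B_1 \times B_2$ is known. *)
Lemma bounded_sequence_distance (u : nat -> 'cV[R]_n) C :
  (forall k, (1 <= k)%N -> dot (u k) (u k) <= C) ->
  exists Omega : set 'cV[R]_n -> R, forall S, 0 <= Omega S /\
    (bounded_set S -> forall k v, (1 <= k)%N -> S v ->
       dot (u k - v) (u k - v) <= Omega S).
Proof.
move=> uC.
have H (S : set 'cV[R]_n) : exists Om, 0 <= Om /\
    (bounded_set S -> forall k v, (1 <= k)%N -> S v ->
       dot (u k - v) (u k - v) <= Om).
  have [/bounded_set_dot[N SN]|nS] := pselect (bounded_set S); last first.
    by exists 0; split.
  exists (2 * C + 2 * `|N|); split.
    by rewrite addr_ge0 // mulr_ge0 // (le_trans (dot_ge0 (u 1%N))) // uC.
  move=> _ k v k1 Sv; rewrite (le_trans (dot_sub_le _ _)) // lerD //.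
    by rewrite ler_pM2l // uC.
  by rewrite ler_pM2l // (le_trans (SN v Sv)) // ler_norm.
by have [Om HOm] := choice H; exists Om.
Qed.

End bounded_distances.

(** * Gap bound for general step sizes *)

Section convergence.
Variables (R : realType) (d r : nat).
Variables (f : 'cV[R]_d -> R) (g : 'cV[R]_r -> R) (B : 'M[R]_(r, d)).
Variables (L lambda : R).
Hypothesis f_convex : convex_function [set: 'cV[R]_d] f.
Hypothesis f_diff : forall x : 'cV[R]_d, differentiable f x.
Hypothesis L_gt0 : 0 < L.
Hypothesis f_lip : forall x x' : 'cV[R]_d,
  norm2 (grad f x - grad f x') <= L * norm2 (x - x').
Hypothesis g_lip : exists Lg : R, forall y y' : 'cV[R]_r,
  `|g y - g y'| <= Lg * norm2 (y - y').
Hypothesis B_neq0 : B != 0.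
Hypothesis lambda_gt0 : 0 < lambda.
Hypothesis lambda_le : lambda <= 1 / rho_max (B *m B^T).

Let M := precond B lambda.

Lemma precond_ge0 u : 0 <= dot (M *m u) u.
Proof.
have rho_gt0 : 0 < rho_max (B *m B^T).
  by have := lt_le_trans lambda_gt0 lambda_le; rewrite div1r invr_gt0.
have sBB : (B *m B^T)^T = B *m B^T by rewrite trmx_mul trmxK.
rewrite /M /precond mulmxBl mul1mx -scalemxAl !dotE subr_ge0.
rewrite (@le_trans _ _ (lambda * (rho_max (B *m B^T) * dot u u))) //.
  by rewrite ler_pM2l // dot_le_rho_max.
by rewrite mulrA -[leRHS]mul1r ler_wpM2r ?dot_ge0 // -ler_pdivlMr.
Qed.

Let rho := rho_max M.

Lemma precond_le u : dot (M *m u) u <= rho * dot u u.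
Proof. exact/dot_le_rho_max/precond_sym. Qed.

Lemma rho_precond_ge0 : 0 <= rho.
Proof.
have /matrix0Pn[i _] := B_neq0.
have u0 : 0 < dot (delta_mx i 0 : 'cV[R]_r) (delta_mx i 0).
  rewrite lt_def dot_ge0 dot_eq0 andbT; apply/matrix0Pn; exists i, 0.
  by rewrite mxE !eqxx oner_eq0.
by rewrite -(pmulr_lge0 _ u0) (le_trans (precond_ge0 _) (precond_le _)).
Qed.

Lemma QgapE xt yt x y : edom (conjugate g) yt -> edom (conjugate g) y ->
  Qgap f g B (xt, yt) (x, y) = (gap f g B xt yt x y)%:E.
Proof. by move=> gyt gy; rewrite /Qgap /Lagr !conjugate_fineE. Qed.

Variables (gamma theta : nat -> R).
Variables (x xag : nat -> 'cV[R]_d) (y yag : nat -> 'cV[R]_r).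
Hypothesis run : APDFP f g B lambda gamma theta x y xag yag.
Hypothesis theta1 : theta 1%N = 1.
Hypothesis theta_gt0 : forall k, (1 <= k)%N -> 0 < theta k.
Hypothesis theta_le1 : forall k, (1 <= k)%N -> theta k <= 1.
Hypothesis gamma_gt0 : forall k, (1 <= k)%N -> 0 < gamma k.
Hypothesis gamma_le : forall k, (1 <= k)%N -> gamma k <= 1 / L.

(** The starting point $y_1$ is arbitrary, so membership begins at the index 2;
    it holds for $y_2^{ag}$ because $\theta_1 = 1$. *)
Lemma edom_iterates yh : edom (conjugate g) yh -> forall k, (1 <= k)%N ->
  edom (conjugate g) (y k.+1) /\ edom (conjugate g) (yag k.+1).
Proof.
move=> gyh; have gy k : (1 <= k)%N -> edom (conjugate g) (y k.+1).
  move=> k1; have [y_prox _ _ _] := APDFP_step run k1.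
  apply: (prox_conjugate _ y_prox (ex_intro _ yh gyh)).1.
  by rewrite !mulr_gt0 ?invr_gt0 ?theta_gt0 ?gamma_gt0.
move=> k k1; split; first exact: gy.
elim: k k1 => // -[_ _|k /(_ isT) IH _].
  have [_ _ _ ->] := APDFP_step run (leqnn 1).
  by rewrite theta1 subrr scale0r add0r scale1r; exact: gy.
have [_ _ _ ->] := APDFP_step run (isT : (1 <= k.+2)%N).
have t0 := theta_gt0 (isT : (1 <= k.+2)%N).
have t1 := theta_le1 (isT : (1 <= k.+2)%N).
have [||] := fconj_convex (t := 1 - theta k.+2) _ _ IH (gy _ (isT : (1 <= k.+2)%N)).
- by rewrite subr_ge0.
- by rewrite gerBl ltW.
by rewrite opprB addrCA subrr addr0.
Qed.

Let a k := theta k ^+ 2 / (2 * gamma k).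
Let b k := gamma k / (2 * lambda).

Lemma gap_rec xz yz : edom (conjugate g) yz -> forall k, (1 <= k)%N ->
  gap f g B (xag k.+1) (yag k.+1) xz yz <=
    (1 - theta k) * gap f g B (xag k) (yag k) xz yz
    + a k * (dot (x k - xz) (x k - xz) - dot (x k.+1 - xz) (x k.+1 - xz))
    + b k * (dot (M *m (y k - yz)) (y k - yz)
             - dot (M *m (y k.+1 - yz)) (y k.+1 - yz)).
Proof.
move=> gyz k k1; have [y_prox xE -> ->] := APDFP_step run k1.
apply: (gap_step f_convex f_diff L_gt0 f_lip lambda_gt0 precond_ge0 xz (theta_gt0 k1)
  (theta_le1 k1) (gamma_gt0 k1) (gamma_le k1) y_prox xE _ gyz).
case: k k1 {y_prox xE} => // -[|k] _; [by left|right].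
exact: (edom_iterates gyz (isT : (1 <= k.+1)%N)).2.
Qed.

Let a_gt0 k : (1 <= k)%N -> 0 < a k.
Proof.
by move=> k1; rewrite divr_gt0 ?exprn_gt0 ?mulr_gt0 ?theta_gt0 ?gamma_gt0.
Qed.

Let b_gt0 k : (1 <= k)%N -> 0 < b k.
Proof. by move=> k1; rewrite divr_gt0 ?mulr_gt0 ?gamma_gt0. Qed.

Variable C : R.
Hypothesis theta_gamma : forall k, (1 <= k)%N ->
  gamma k.+1 / gamma k <= theta k.+1 ^+ 2 / (theta k ^+ 2 * (1 - theta k.+1)).
Hypothesis gamma_decr : forall k, (1 <= k)%N ->
  gamma k / gamma k.+1 <= 1 / (1 - theta k.+1).
Hypothesis theta_lt1 : forall k, (1 <= k)%N -> theta k.+1 < 1.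
Hypothesis ratio_incr : forall k, (1 <= k)%N ->
  gamma k ^+ 2 / theta k ^+ 2 <= gamma k.+1 ^+ 2 / theta k.+1 ^+ 2.
Hypothesis ratio_le : forall k, (1 <= k)%N -> gamma k ^+ 2 / theta k ^+ 2 <= C.

Let a_decr k : (1 <= k)%N -> (1 - theta k.+1) * a k <= a k.+1.
Proof.
move=> k1; have := theta_gamma k1.
have g1 := gamma_gt0 k1; have g2 := gamma_gt0 (ltn0Sn k).
have t1 := theta_gt0 k1; have t2 := theta_gt0 (ltn0Sn k).
have s0 : 0 < 1 - theta k.+1 by rewrite subr_gt0 theta_lt1.
rewrite /a ler_pdivlMr ?mulr_gt0 ?exprn_gt0 // => H.
rewrite ler_pdivlMr ?mulr_gt0 //; apply: le_trans H.
rewrite le_eqVlt; apply/orP; left; apply/eqP; field; rewrite gt_eqF //.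
Qed.

Let b_decr k : (1 <= k)%N -> (1 - theta k.+1) * b k <= b k.+1.
Proof.
move=> k1; have := gamma_decr k1; have g2 := gamma_gt0 (ltn0Sn k).
have s0 : 0 < 1 - theta k.+1 by rewrite subr_gt0 theta_lt1.
rewrite ler_pdivrMr // mulrAC mul1r ler_pdivlMr // mulrC => H.
by rewrite /b mulrA ler_wpM2r // invr_ge0 ltW // mulr_gt0.
Qed.

Let b_div_a k : (1 <= k)%N -> b k / a k = lambda^-1 * (gamma k ^+ 2 / theta k ^+ 2).
Proof.
move=> k1; rewrite /a /b; field; rewrite !gt_eqF ?theta_gt0 ?gamma_gt0 //.
Qed.

Lemma dual_bounded : (edom (conjugate g) !=set0) ->
  exists D, forall k, (1 <= k)%N -> dot (y k) (y k) <= D.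
Proof.
move=> [yh gyh]; have [Lg Lg_lip] := g_lip; exists (dot (y 1%N) (y 1%N) + Lg ^+ 2).
move=> -[//|[|k]] _; first by rewrite lerDl sqr_ge0.
rewrite ler_wpDl ?dot_ge0 // (edom_conjugate_bounded Lg_lip) //.
exact: (edom_iterates gyh (isT : (1 <= k.+1)%N)).1.
Qed.

(** At a saddle point the gap is nonnegative, and the boundedness of the dual
    iterates closes [distance_recursion_bound]. *)
Lemma primal_bounded zh : saddle_point f g B zh ->
  exists D, forall k, (1 <= k)%N -> dot (x k) (x k) <= D.
Proof.
case: zh => xh yh [/= gyh saddle]; have [D yD] := dual_bounded (ex_intro _ yh gyh).
pose X k := dot (x k - xh) (x k - xh).
pose V := rho * (2 * D + 2 * dot yh yh).
have XC k : (1 <= k)%N -> X k.+1 <= X 1%N + lambda^-1 * C * V.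
  move: k; apply: (distance_recursion_bound theta1 a_gt0 (fun k k1 => ltW (b_gt0 k1))
    a_decr (gap_rec xh gyh)) => [[//|[//|k]] _|k k1|k k1].
  - have [_ gyag] := edom_iterates gyh (isT : (1 <= k.+1)%N).
    have := saddle (xag k.+2, yag k.+2) gyag; rewrite QgapE // lee_fin /gap; lra.
  - rewrite !b_div_a // !ler_pM2l ?invr_gt0 //.
    by rewrite ratio_incr // ratio_le.
  - rewrite precond_ge0 (le_trans (precond_le _)) //.
    rewrite ler_wpM2l ?rho_precond_ge0 // (le_trans (dot_sub_le _ _)) //.
    by rewrite lerD2r ler_pM2l // yD.
exists (2 * (X 1%N + `|lambda^-1 * C * V|) + 2 * dot xh xh) => k k1.
have -> : x k = (x k - xh) - (- xh) by rewrite opprK subrK.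
rewrite (le_trans (dot_sub_le _ _)) // dotNl dotNr opprK lerD2r ler_pM2l //.
case: k k1 => // -[_|k _]; first by rewrite lerDl.
by rewrite (le_trans (XC k.+1 isT)) // lerD2l ler_norm.
Qed.

Theorem apdfp_gap_bound : (exists zh, saddle_point f g B zh) ->
  exists (Omega1 : set 'cV[R]_d -> R) (Omega2 : set 'cV[R]_r -> R),
  forall (B1 : set 'cV[R]_d) (B2 : set 'cV[R]_r),
  bounded_set B1 -> bounded_set B2 -> B2 `<=` edom (conjugate g) ->
  [/\ 0 <= Omega1 B1, 0 <= Omega2 B2 &
      forall k : nat, (1 <= k)%N ->
      (partial_gap f g B B1 B2 (xag k.+1, yag k.+1)
       <= (theta k ^+ 2 / (2 * gamma k) * Omega1 B1
           + gamma k / (2 * lambda) * (rho * Omega2 B2))%:E)%E].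
Proof.
move=> [zh saddle]; have gyh := saddle.1.
have [Dx /bounded_sequence_distance[Om1 HOm1]] := primal_bounded saddle.
have [Dy /bounded_sequence_distance[Om2 HOm2]] := dual_bounded (ex_intro _ zh.2 gyh).
exists Om1, Om2 => B1 B2 /((HOm1 B1).2) B1Om /((HOm2 B2).2) B2Om B2g.
split=> [||k k1]; [exact: (HOm1 B1).1|exact: (HOm2 B2).1|].
apply: ge_ereal_sup => _ [[xz yz] [/= B1x B2y] <-].
have gyz := B2g _ B2y; rewrite QgapE //; last exact: (edom_iterates gyz k1).2.
rewrite lee_fin; move: k k1.
apply: (gap_recursion_bound theta1 theta_le1 a_gt0 (fun k k1 => ltW (b_gt0 k1))
  a_decr b_decr (gap_rec xz gyz)) => k k1; first by rewrite dot_ge0 B1Om.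
rewrite precond_ge0 (le_trans (precond_le _)) //.
by rewrite ler_wpM2l ?rho_precond_ge0 ?B2Om.
Qed.

End convergence.

(** * The step sizes of the corollary *)

Section step_sizes.
Variables (R : realFieldType) (L c : R).
Hypotheses (L_gt0 : 0 < L) (c_gt0 : 0 < c) (c_lt : c < L).

Let theta (k : nat) : R := 2 / (k%:R + 1).
Let gamma (k : nat) : R := 1 / (L + c * k%:R).

Let k_ge1 k : (1 <= k)%N -> 1 <= k%:R :> R.
Proof. by rewrite ler1n. Qed.

Let den_gt0 k : 0 < L + c * k%:R.
Proof. by rewrite ltr_pwDl // mulr_ge0 // ltW. Qed.

Lemma theta_gt0 k : 0 < theta k.
Proof. by rewrite divr_gt0 // ltr_wpDl. Qed.

Lemma theta_le1 k : (1 <= k)%N -> theta k <= 1.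
Proof. by move=> /k_ge1 n1; rewrite ler_pdivrMr; lra. Qed.

Lemma theta_lt1 k : (1 <= k)%N -> theta k.+1 < 1.
Proof. by move=> /k_ge1 n1; rewrite ltr_pdivrMr -[k.+1%:R]natr1; lra. Qed.

Lemma gamma_gt0 k : 0 < gamma k.
Proof. by rewrite divr_gt0. Qed.

Lemma gamma_le k : gamma k <= 1 / L.
Proof. by rewrite /gamma !div1r lef_pV2 ?posrE // lerDl mulr_ge0 // ltW. Qed.

Lemma gamma_theta_ratio k : (1 <= k)%N ->
  gamma k.+1 / gamma k <= theta k.+1 ^+ 2 / (theta k ^+ 2 * (1 - theta k.+1)).
Proof.
move=> /k_ge1 n1; have d1 := den_gt0 k; have d2 := den_gt0 k.+1.
apply: (@le_trans _ _ 1).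
  rewrite ler_pdivrMr ?gamma_gt0 // /gamma !mul1r lef_pV2 ?posrE //.
  by rewrite -[k.+1%:R]natr1 mulrDr mulr1 addrA lerDl ltW.
rewrite /theta -[k.+1%:R]natr1; move: (k%:R : R) n1 => n n1.
have -> : (2 / (n + 1 + 1)) ^+ 2 / ((2 / (n + 1)) ^+ 2 * (1 - 2 / (n + 1 + 1))) =
    (n + 1) ^+ 2 / (n * (n + 2)).
  field; rewrite !gt_eqF //; lra.
rewrite ler_pdivlMr; first by lra.
by rewrite mulr_gt0 //; lra.
Qed.

Lemma gamma_ratio k : (1 <= k)%N -> gamma k / gamma k.+1 <= 1 / (1 - theta k.+1).
Proof.
move=> /k_ge1 n1; have := den_gt0 k; have := den_gt0 k.+1.
rewrite /gamma /theta -[k.+1%:R]natr1; move: (k%:R : R) n1 => n n1 d2 d1.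
have -> : 1 / (1 - 2 / (n + 1 + 1)) = (n + 2) / n.
  field; rewrite !gt_eqF //; lra.
have -> : 1 / (L + c * n) / (1 / (L + c * (n + 1))) =
    (L + c * (n + 1)) / (L + c * n).
  by field; rewrite !gt_eqF.
rewrite ler_pdivrMr // mulrAC ler_pdivlMr; last lra.
have : 0 <= c * n by rewrite mulr_ge0 ?(ltW c_gt0) ?(le_trans ler01 n1).
by have := L_gt0; lra.
Qed.

Let ratioE k :
  gamma k ^+ 2 / theta k ^+ 2 = ((k%:R + 1) / (2 * (L + c * k%:R))) ^+ 2.
Proof.
by rewrite /gamma /theta; field; rewrite !gt_eqF // ltr_wpDl.
Qed.

Lemma gamma_theta_incr k : 
  gamma k ^+ 2 / theta k ^+ 2 < gamma k.+1 ^+ 2 / theta k.+1 ^+ 2.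
Proof.
rewrite !ratioE; have d1 := den_gt0 k; have d2 := den_gt0 k.+1.
have n0 : 0 <= k%:R :> R by [].
rewrite ltrXn2r ?nnegrE ?divr_ge0 ?addr_ge0 ?mulr_ge0 ?(ltW d1) ?(ltW d2) //.
rewrite ltr_pdivrMr ?mulr_gt0 // mulrAC ltr_pdivlMr ?mulr_gt0 //.
have := c_lt; rewrite -[k.+1%:R]natr1; move: (k%:R : R) n0 => n n0; lra.
Qed.

Lemma gamma_theta_bounded k : (1 <= k)%N ->
  gamma k ^+ 2 / theta k ^+ 2 <= (c^-1) ^+ 2.
Proof.
move=> /k_ge1 n1; rewrite !ratioE; have d1 := den_gt0 k.
rewrite lerXn2r ?nnegrE ?divr_ge0 ?addr_ge0 ?mulr_ge0 ?invr_ge0 ?(ltW d1)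
  ?(ltW c_gt0) //.
rewrite ler_pdivrMr ?mulr_gt0 // -(ler_pM2l c_gt0) mulrA divff ?gt_eqF // mul1r.
have := L_gt0; have := c_gt0; nra.
Qed.

End step_sizes.

(** * Convergence rate *)

Theorem corollary3p3 (R : realType) (d r : nat)
  (f : 'cV[R]_d -> R) (g : 'cV[R]_r -> R) (B : 'M[R]_(r, d)) (Lf lambda c : R)
  (f_convex : convex_function [set: 'cV[R]_d] f)
  (f_diff : forall x : 'cV[R]_d, differentiable f x)
  (Lf_gt0 : 0 < Lf)
  (f_lip : forall x x' : 'cV[R]_d,
    norm2 (grad f x - grad f x') <= Lf * norm2 (x - x'))
  (g_convex : convex_function [set: 'cV[R]_r] g)
  (g_lip : exists Lg : R, forall y y' : 'cV[R]_r,
    `|g y - g y'| <= Lg * norm2 (y - y'))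
  (B_neq0 : B != 0)
  (lambda_gt0 : 0 < lambda)
  (lambda_le : lambda <= 1 / rho_max (B *m B^T))
  (c_gt0 : 0 < c) (c_lt : c < Lf) :
  let theta (k : nat) : R := 2 / (k%:R + 1) in
  let gamma (k : nat) : R := 1 / (Lf + c * k%:R) in
  [/\ forall k : nat, (1 <= k)%N ->
        [/\ 0 < gamma k <= 1 / Lf,
            gamma k.+1 / gamma k
              <= theta k.+1 ^+ 2 / (theta k ^+ 2 * (1 - theta k.+1)) &
            gamma k / gamma k.+1 <= 1 / (1 - theta k.+1)],
      forall k : nat, (1 <= k)%N ->
        gamma k ^+ 2 / theta k ^+ 2 < gamma k.+1 ^+ 2 / theta k.+1 ^+ 2,
      exists M : R, forall k : nat, (1 <= k)%N ->
        `|gamma k ^+ 2 / theta k ^+ 2| <= M,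
      theta 1%N = 1 &
      forall (x : nat -> 'cV[R]_d) (y : nat -> 'cV[R]_r)
             (xag : nat -> 'cV[R]_d) (yag : nat -> 'cV[R]_r),
        APDFP f g B lambda gamma theta x y xag yag ->
        (exists zh, saddle_point f g B zh) ->
        exists (Omega1 : set 'cV[R]_d -> R) (Omega2 : set 'cV[R]_r -> R),
        forall (B1 : set 'cV[R]_d) (B2 : set 'cV[R]_r),
          bounded_set B1 -> bounded_set B2 ->
          B2 `<=` edom (conjugate g) ->
          (exists2 zh, (B1 `*` B2) zh & saddle_point f g B zh) ->
          [/\ 0 <= Omega1 B1, 0 <= Omega2 B2 &
              forall k : nat, (1 <= k)%N ->
              (partial_gap f g B B1 B2 (xag k.+1, yag k.+1)
               <= (2 * Lf / (k%:R + 1) ^+ 2 * Omega1 B1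
                   + 2 * c * k%:R / (k%:R + 1) ^+ 2 * Omega1 B1
                   + 1 / (2 * (Lf + c * k%:R))
                     * (rho_max (1%:M - lambda *: (B *m B^T)) / lambda)
                     * Omega2 B2)%:E)%E]].
Proof.
move=> theta gamma.
have theta1 : theta 1%N = 1 by rewrite /theta divff // lt0r_neq0.
split=> //.
- move=> k k1; split; first by rewrite gamma_gt0 // gamma_le.
  + exact: gamma_theta_ratio.
  + exact: gamma_ratio.
- by move=> k _; exact: gamma_theta_incr.
- exists (c^-1 ^+ 2) => k k1; rewrite ger0_norm ?divr_ge0 ?sqr_ge0 //.
  exact: gamma_theta_bounded.
move=> x y xag yag run saddle.
have [Om1 [Om2 bound]] := apdfp_gap_bound
  f_convex f_diff Lf_gt0 f_lip g_lip B_neq0 lambda_gt0 lambda_le run theta1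
  (fun k _ => theta_gt0 R k) (@theta_le1 R)
  (fun k _ => gamma_gt0 Lf_gt0 c_gt0 k) (fun k _ => gamma_le Lf_gt0 c_gt0 k)
  (gamma_theta_ratio Lf_gt0 c_gt0) (gamma_ratio Lf_gt0 c_gt0) (@theta_lt1 R)
  (fun k _ => ltW (gamma_theta_incr Lf_gt0 c_gt0 c_lt k))
  (gamma_theta_bounded Lf_gt0 c_gt0) saddle.
exists Om1, Om2 => B1 B2 bB1 bB2 B2g _.
have [Om1_ge0 Om2_ge0 gap_le] := bound B1 B2 bB1 bB2 B2g.
split=> // k k1; rewrite (le_trans (gap_le k k1)) // lee_fin.
rewrite le_eqVlt; apply/orP; left; apply/eqP.
rewrite /precond; move: (rho_max _) => rho; rewrite /theta /gamma.
have k1_gt0 : 0 < k%:R + 1 :> R by rewrite ltr_wpDl.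
have den_gt0 : 0 < Lf + c * k%:R by rewrite ltr_pwDl // mulr_ge0 // ltW.
by field; rewrite !gt_eqF.
Qed.
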